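(* Let $0<q<1$, let $\mathcal{U}_q=\mathcal{U}_q(\mathfrak{sl}(2,\mathbb{C}))$ with comultiplication $\Delta$, Casimir element $\Omega$, and let $a_{\hat E},a_{\hat F},a_s,b_{\hat E},b_{\hat F},b_t\in\mathbb{C}$. Put $$Y_K=q^{1/2}a_{\hat E}\hat E\hat K+q^{-1/2}a_{\hat F}\hat F\hat K+a_s\hat K^2,\qquad Y_L=q^{-1/2}b_{\hat E}\hat E\hat K^{-1}+q^{1/2}b_{\hat F}\hat F\hat K^{-1}+b_t\hat K^{-2},$$ and $\theta=-(\sinh_q(1))^{-2}(a_{\hat E}b_{\hat F}+a_{\hat F}b_{\hat E})$. Then each pair of the elements $$1\otimes Y_K,\quad \Delta(Y_K),\quad Y_L\otimes 1,\quad \Delta(Y_L),\quad \Delta(\Omega)$$ of $\mathcal{U}_q\otimes\mathcal{U}_q$ either commutes or satisfies the AW-relations. The pairs of non-commuting elements satisfy the AW-relations as follows (the notation $\mathscr{AW}(K,L\mid A_0,\dots,A_5)=0$ is defined in the context; scalars are identified with scalar multiples of $1\otimes1$): 1. $\mathscr{AW}\big(\Delta(Y_K),\Delta(Y_L)\mid a_s,\ b_t,\ \theta,\ \Delta(\Omega),\ b_{\hat E}b_{\hat F},\ a_{\hat E}a_{\hat F}\big)=0$; 2. $\mathscr{AW}\big(1\otimes Y_K,\Delta(Y_L)\mid a_s,\ Y_L\otimes1,\ \theta,\ 1\otimes\Omega,\ b_{\hat E}b_{\hat F},\ a_{\hat E}a_{\hat F}\big)=0$; 3. $\mathscr{AW}\big(\Delta(Y_K),Y_L\otimes1\mid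 1\otimes Y_K,\ b_t,\ \theta,\ \Omega\otimes1,\ b_{\hat E}b_{\hat F},\ a_{\hat E}a_{\hat F}\big)=0$; 4. $\mathscr{AW}\big(1\otimes Y_K,\Delta(\Omega)\mid a_s,\ \Omega\otimes1,\ -\Delta(Y_K),\ 1\otimes\Omega,\ -(\sinh_q(1))^2,\ a_{\hat E}a_{\hat F}\big)=0$; 5. $\mathscr{AW}\big(\Delta(\Omega),Y_L\otimes1\mid 1\otimes\Omega,\ b_t,\ -\Delta(Y_L),\ \Omega\otimes1,\ b_{\hat E}b_{\hat F},\ -(\sinh_q(1))^2\big)=0$; and each of the remaining pairs among the five elements commutes.
   Context: Notation: $\sinh_q(x)=q^x-q^{-x}$ and $\cosh_q(x)=q^x+q^{-x}$ (no factor $1/2$). $\mathcal{U}_q$ is the unital associative complex algebra generated by $\hat K,\hat K^{-1},\hat E,\hat F$ with relations $\hat K\hat K^{-1}=1=\hat K^{-1}\hat K$, $\hat K\hat E=q\hat E\hat K$, $\hat K\hat F=q^{-1}\hat F\hat K$, $\hat E\hat F-\hat F\hat E=\dfrac{\hat K^2-\hat K^{-2}}{q-q^{-1}}$. The comultiplication is the algebra homomorphism $\Delta:\mathcal{U}_q\to\mathcal{U}_q\otimes\mathcal{U}_q$ with $\Delta(\hat K^{\pm1})=\hat K^{\pm1}\otimes\hat K^{\pm1}$, $\Delta(\hat E)=\hat K\otimes\hat E+\hat E\otimes\hat K^{-1}$, $\Delta(\hat F)=\hat K\otimes\hat F+\hat F\otimes\hat K^{-1}$. The Casimir element is $\Omega=q^{-1}\hat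 K^2+q\hat K^{-2}+(\sinh_q(1))^2\hat E\hat F$ (central in $\mathcal{U}_q$). AW-relations: for elements $K,L,A_0,\dots,A_5$ of a unital algebra, $\mathscr{AW}(K,L\mid A_0,A_1,A_2,A_3,A_4,A_5)=0$ means that both $$\cosh_q(2)KLK-K^2L-LK^2=(\sinh_q(1))^2(A_0A_1-A_2A_3)K-(\cosh_q(1))^2A_5L+\cosh_q(1)\big(A_1A_3A_5+(\sinh_q(1))^2A_0A_2\big),$$ $$\cosh_q(2)LKL-L^2K-KL^2=(\sinh_q(1))^2(A_0A_1-A_2A_3)L-(\cosh_q(1))^2A_4K+\cosh_q(1)\big(A_0A_3A_4+(\sinh_q(1))^2A_1A_2\big)$$ hold. *)

(* Defs.v *)
From HB Require Import structures.
From mathcomp Require Import all_boot all_order all_algebra.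
From mathcomp Require Import complex.
From mathcomp Require Import boolp reals exp.

Set Implicit Arguments.
Unset Strict Implicit.
Unset Printing Implicit Defensive.

Import Order.TTheory GRing.Theory Num.Theory.
Local Open Scope ring_scope.
Local Open Scope complex_scope.
Local Open Scope quotient_scope.

Reserved Notation "a \ox b" (at level 35, no associativity).

Section Tensor.
Variables (C : comNzRingType) (A B : algType C).

(* A list of pairs stands for the formal sum of the corresponding pure tensors;
   the tensor product is the quotient by the congruence generated by
   bilinearity. *)
Inductive tensor_eq : seq (A * B) -> seq (A * B) -> Prop :=
| teq_refl s : tensor_eq s s
| teq_sym s t : tensor_eq s t -> tensor_eq t s
| teq_trans s t u : tensor_eq s t -> tensor_eq t u -> tensor_eq s u
| teq_cat s s' t t' :
    tensor_eq s s' -> tensor_eq t t' -> tensor_eq (s ++ t) (s' ++ t')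
| teq_catC s t : tensor_eq (s ++ t) (t ++ s)
| teq_zero b : tensor_eq [:: (0, b)] [::]
| teq_addl a a' b : tensor_eq [:: (a + a', b)] [:: (a, b); (a', b)]
| teq_addr a b b' : tensor_eq [:: (a, b + b')] [:: (a, b); (a, b')]
| teq_scale c a b : tensor_eq [:: (c *: a, b)] [:: (a, c *: b)].

Definition tensor_eqb (s t : seq (A * B)) : bool := `[< tensor_eq s t >].

Fact tensor_eqb_refl : reflexive tensor_eqb.
Proof. by move=> s; apply/asboolP; apply: teq_refl. Qed.
Fact tensor_eqb_sym : symmetric tensor_eqb.
Proof. by move=> s t; apply/asboolP/asboolP; apply: teq_sym. Qed.
Fact tensor_eqb_trans : transitive tensor_eqb.
Proof.
by move=> t s u /asboolP st /asboolP tu; apply/asboolP; apply: teq_trans tu.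
Qed.

Canonical tensor_equiv :=
  EquivRel tensor_eqb tensor_eqb_refl tensor_eqb_sym tensor_eqb_trans.

Definition tensor : Type := {eq_quot tensor_equiv}.
HB.instance Definition _ := Choice.on tensor.

Definition tensor_pi (s : seq (A * B)) : tensor := \pi_{eq_quot tensor_equiv} s.
Definition tensor_repr (x : tensor) : seq (A * B) :=
  repr (x : {eq_quot tensor_equiv}).

Lemma tensor_reprK x : tensor_pi (tensor_repr x) = x.
Proof. exact: reprK. Qed.

Lemma tensor_piP s t : tensor_pi s = tensor_pi t <-> tensor_eq s t.
Proof.
split=> [/eqmodP /asboolP //|st].
by apply/eqmodP/asboolP.
Qed.

Lemma tensor_piK s : tensor_eq (tensor_repr (tensor_pi s)) s.
Proof. by apply/tensor_piP; rewrite tensor_reprK. Qed.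

Definition tpure (a : A) (b : B) : tensor := tensor_pi [:: (a, b)].

Definition tscale_seq (c : C) (s : seq (A * B)) := [seq (c *: x.1, x.2) | x <- s].
Definition tmul_seq (s t : seq (A * B)) :=
  [seq (x.1 * y.1, x.2 * y.2) | x <- s, y <- t].

Definition tzero : tensor := tensor_pi [::].
Definition tadd (x y : tensor) := tensor_pi (tensor_repr x ++ tensor_repr y).
Definition tscale c (x : tensor) := tensor_pi (tscale_seq c (tensor_repr x)).
Definition topp (x : tensor) := tscale (-1) x.
Definition tone : tensor := tpure 1 1.
Definition tmul (x y : tensor) :=
  tensor_pi (tmul_seq (tensor_repr x) (tensor_repr y)).

Let pad s t : tensor_eq s t -> tensor_pi s = tensor_pi t.
Proof. by move/tensor_piP. Qed.

Lemma tadd_pi s t : tadd (tensor_pi s) (tensor_pi t) = tensor_pi (s ++ t).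
Proof. by apply: pad; apply: teq_cat; apply: tensor_piK. Qed.

Lemma tscale_seq_eq c s t :
  tensor_eq s t -> tensor_eq (tscale_seq c s) (tscale_seq c t).
Proof.
elim=> {s t}.
- by move=> s; apply: teq_refl.
- by move=> s t _; apply: teq_sym.
- by move=> s t u _ st _; apply: teq_trans.
- by move=> s s' t t' _ ss' _ tt'; rewrite /tscale_seq !map_cat; apply: teq_cat.
- by move=> s t; rewrite /tscale_seq !map_cat; apply: teq_catC.
- by move=> b /=; rewrite scaler0; apply: teq_zero.
- by move=> a a' b /=; rewrite scalerDr; apply: teq_addl.
- by move=> a b b' /=; apply: teq_addr.
- by move=> d a b /=; rewrite scalerA mulrC -scalerA; apply: teq_scale.
Qed.

Lemma tscale_pi c s : tscale c (tensor_pi s) = tensor_pi (tscale_seq c s).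
Proof. by apply: pad; apply: tscale_seq_eq; apply: tensor_piK. Qed.

Lemma tmul_seq_catl s t u :
  tmul_seq (s ++ t) u = tmul_seq s u ++ tmul_seq t u.
Proof. by rewrite /tmul_seq allpairs_cat. Qed.

Lemma teq_catACA s t u v :
  tensor_eq ((s ++ t) ++ (u ++ v)) ((s ++ u) ++ (t ++ v)).
Proof.
rewrite -!catA; apply: teq_cat; first exact: teq_refl.
rewrite !catA; apply: teq_cat; last exact: teq_refl.
exact: teq_catC.
Qed.

Lemma tmul_seq_catr s t u :
  tensor_eq (tmul_seq s (t ++ u)) (tmul_seq s t ++ tmul_seq s u).
Proof.
elim: s => [|x s IHs]; first exact: teq_refl.
rewrite -cat1s !tmul_seq_catl.
apply: teq_trans (teq_catACA _ _ _ _).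
apply: teq_cat => //.
by rewrite /tmul_seq /= !cats0 map_cat; apply: teq_refl.
Qed.

Lemma tmul_seq_nilr s : tmul_seq s [::] = [::].
Proof. by elim: s. Qed.

Lemma tmul_seq_eql1 s s' t :
  (forall y, tensor_eq (tmul_seq s [:: y]) (tmul_seq s' [:: y])) ->
  tensor_eq (tmul_seq s t) (tmul_seq s' t).
Proof.
move=> H; elim: t => [|y t IHt]; first by rewrite !tmul_seq_nilr; apply: teq_refl.
rewrite -cat1s; apply: teq_trans (tmul_seq_catr _ _ _) _.
apply: teq_trans (teq_sym (tmul_seq_catr _ _ _)).
exact: teq_cat.
Qed.

Lemma tmul_seq_eql s s' t :
  tensor_eq s s' -> tensor_eq (tmul_seq s t) (tmul_seq s' t).
Proof.
elim=> {s s'}.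
- by move=> s; apply: teq_refl.
- by move=> s s' _; apply: teq_sym.
- by move=> s s' u _ st _; apply: teq_trans.
- by move=> s s' u u' _ ss' _ tt'; rewrite !tmul_seq_catl; apply: teq_cat.
- by move=> s u; rewrite !tmul_seq_catl; apply: teq_catC.
- move=> b; apply: (@tmul_seq_eql1 _ [::]) => -[a' b']; rewrite /tmul_seq /=.
  by rewrite mul0r; apply: teq_zero.
- move=> a a' b; apply: tmul_seq_eql1 => -[a2 b2]; rewrite /tmul_seq /=.
  by rewrite mulrDl; apply: teq_addl.
- move=> a b b'; apply: tmul_seq_eql1 => -[a2 b2]; rewrite /tmul_seq /=.
  by rewrite mulrDl; apply: teq_addr.
- move=> c a b; apply: tmul_seq_eql1 => -[a2 b2]; rewrite /tmul_seq /=.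
  by rewrite -!scalerAl; apply: teq_scale.
Qed.

Lemma tmul_seq_eqr1 s t t' :
  (forall x, tensor_eq (tmul_seq [:: x] t) (tmul_seq [:: x] t')) ->
  tensor_eq (tmul_seq s t) (tmul_seq s t').
Proof.
move=> H; elim: s => [|x s IHs]; first exact: teq_refl.
by rewrite -cat1s !tmul_seq_catl; apply: teq_cat.
Qed.

Lemma tmul_seq_eqr s t t' :
  tensor_eq t t' -> tensor_eq (tmul_seq s t) (tmul_seq s t').
Proof.
elim=> {t t'}.
- by move=> t; apply: teq_refl.
- by move=> t t' _; apply: teq_sym.
- by move=> t t' u _ st _; apply: teq_trans.
- move=> t t' u u' _ tt' _ uu'; apply: teq_trans (tmul_seq_catr _ _ _) _.
  by apply: teq_trans (teq_sym (tmul_seq_catr _ _ _)); apply: teq_cat.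
- move=> t u; apply: teq_trans (tmul_seq_catr _ _ _) _.
  by apply: teq_trans (teq_sym (tmul_seq_catr _ _ _)); apply: teq_catC.
- move=> b; apply: tmul_seq_eqr1 => -[a' b']; rewrite /tmul_seq /=.
  by rewrite mulr0; apply: teq_zero.
- move=> a a' b; apply: tmul_seq_eqr1 => -[a2 b2]; rewrite /tmul_seq /=.
  by rewrite mulrDr; apply: teq_addl.
- move=> a b b'; apply: tmul_seq_eqr1 => -[a2 b2]; rewrite /tmul_seq /=.
  by rewrite mulrDr; apply: teq_addr.
- move=> c a b; apply: tmul_seq_eqr1 => -[a2 b2]; rewrite /tmul_seq /=.
  by rewrite -!scalerAr; apply: teq_scale.
Qed.

Lemma tmul_pi s t :
  tmul (tensor_pi s) (tensor_pi t) = tensor_pi (tmul_seq s t).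
Proof.
apply: pad; apply: teq_trans (tmul_seq_eql _ (tensor_piK s)) _.
exact: tmul_seq_eqr (tensor_piK t).
Qed.

#[local] Opaque tadd tscale tmul.

Lemma taddA : associative tadd.
Proof.
move=> x y z; rewrite -[x]tensor_reprK -[y]tensor_reprK -[z]tensor_reprK.
by rewrite !tadd_pi catA.
Qed.
Lemma taddC : commutative tadd.
Proof.
move=> x y; rewrite -[x]tensor_reprK -[y]tensor_reprK !tadd_pi.
by apply: pad; apply: teq_catC.
Qed.
Lemma tadd0 : left_id tzero tadd.
Proof. by move=> x; rewrite -[x]tensor_reprK /tzero tadd_pi. Qed.

Lemma taddN : left_inverse tzero topp tadd.
Proof.
move=> x; rewrite -[x]tensor_reprK /topp tscale_pi tadd_pi; apply: pad.
elim: (tensor_repr x) => [|[a b] s IHs]; first exact: teq_refl.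
rewrite -[_ :: s]cat1s /tscale_seq map_cat.
apply: teq_trans (teq_catACA _ _ _ _) _.
rewrite -[[::] in X in tensor_eq _ X]cats0; apply: teq_cat => //=.
rewrite scaleN1r; apply: teq_trans (teq_sym (teq_addl _ _ _)) _.
by rewrite addNr; apply: teq_zero.
Qed.

HB.instance Definition _ := GRing.isZmodule.Build tensor taddA taddC tadd0 taddN.

Lemma tensor_pi_cat s t : tensor_pi (s ++ t) = tensor_pi s + tensor_pi t.
Proof. by rewrite -tadd_pi. Qed.

Lemma tensor_ind (P : tensor -> Prop) :
  P 0 -> (forall a b x, P x -> P (tpure a b + x)) -> forall x, P x.
Proof.
move=> P0 PS x; rewrite -[x]tensor_reprK.
elim: (tensor_repr x) => [|[a b] s IHs]; first exact: P0.
by rewrite -cat1s tensor_pi_cat; apply: PS.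
Qed.

Lemma tpureDl a a' b : tpure (a + a') b = tpure a b + tpure a' b.
Proof. by rewrite /tpure -tensor_pi_cat; apply: pad; apply: teq_addl. Qed.
Lemma tpureDr a b b' : tpure a (b + b') = tpure a b + tpure a b'.
Proof. by rewrite /tpure -tensor_pi_cat; apply: pad; apply: teq_addr. Qed.
Lemma tpure_balanced c a b : tpure (c *: a) b = tpure a (c *: b).
Proof. by apply: pad; apply: teq_scale. Qed.

Lemma tscaleDr c : {morph tscale c : x y / x + y}.
Proof.
move=> x y; rewrite -[x]tensor_reprK -[y]tensor_reprK -tensor_pi_cat.
by rewrite !tscale_pi /tscale_seq map_cat tensor_pi_cat.
Qed.
Lemma tscale0 c : tscale c 0 = 0.
Proof. exact: tscale_pi. Qed.
Lemma tscale_pure c a b : tscale c (tpure a b) = tpure (c *: a) b.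
Proof. exact: tscale_pi. Qed.

Lemma tscaleA c d x : tscale c (tscale d x) = tscale (c * d) x.
Proof.
elim/tensor_ind: x => [|a b x IHx]; first by rewrite !tscale0.
by rewrite !tscaleDr !tscale_pure IHx scalerA.
Qed.
Lemma tscale1 : left_id 1 tscale.
Proof.
elim/tensor_ind=> [|a b x IHx]; first by rewrite tscale0.
by rewrite tscaleDr tscale_pure IHx scale1r.
Qed.
Lemma tscaleDl x : {morph tscale^~ x : c d / c + d}.
Proof.
move=> c d; elim/tensor_ind: x => [|a b x IHx]; first by rewrite !tscale0 addr0.
by rewrite !tscaleDr !tscale_pure IHx scalerDl tpureDl addrACA.
Qed.

HB.instance Definition _ :=
  GRing.Zmodule_isLmodule.Build C tensor tscaleA tscale1 tscaleDr tscaleDl.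

Lemma tpureZl c a b : tpure (c *: a) b = c *: tpure a b.
Proof. by rewrite -tscale_pure. Qed.
Lemma tpureZr c a b : tpure a (c *: b) = c *: tpure a b.
Proof. by rewrite -tpure_balanced tpureZl. Qed.

Lemma tmulDl : left_distributive tmul +%R.
Proof.
move=> x y z; rewrite -[x]tensor_reprK -[y]tensor_reprK -[z]tensor_reprK.
by rewrite -tensor_pi_cat !tmul_pi tmul_seq_catl tensor_pi_cat.
Qed.
Lemma tmulDr : right_distributive tmul +%R.
Proof.
move=> x y z; rewrite -[x]tensor_reprK -[y]tensor_reprK -[z]tensor_reprK.
rewrite -tensor_pi_cat !tmul_pi -tensor_pi_cat.
by apply: pad; apply: tmul_seq_catr.
Qed.
Lemma tmul0r x : tmul 0 x = 0.
Proof. by rewrite -[x]tensor_reprK tmul_pi. Qed.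
Lemma tmulr0 x : tmul x 0 = 0.
Proof. by rewrite -[x]tensor_reprK tmul_pi tmul_seq_nilr. Qed.
Lemma tmul_pure a b a' b' : tmul (tpure a b) (tpure a' b') = tpure (a * a') (b * b').
Proof. by rewrite /tpure tmul_pi. Qed.

Lemma tmulA : associative tmul.
Proof.
move=> x y z.
elim/tensor_ind: x => [|a b x IHx]; first by rewrite !tmul0r.
rewrite !tmulDl IHx; congr (_ + _).
elim/tensor_ind: y {IHx} => [|a' b' y IHy]; first by rewrite tmul0r !tmulr0 tmul0r.
rewrite tmulDl !tmulDr tmulDl IHy; congr (_ + _).
elim/tensor_ind: z {IHy} => [|a2 b2 z IHz]; first by rewrite !tmulr0.
by rewrite !tmulDr IHz !tmul_pure !mulrA.
Qed.
Lemma tmul1r : left_id tone tmul.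
Proof.
elim/tensor_ind=> [|a b x IHx]; first by rewrite tmulr0.
by rewrite tmulDr IHx tmul_pure !mul1r.
Qed.
Lemma tmulr1 : right_id tone tmul.
Proof.
elim/tensor_ind=> [|a b x IHx]; first by rewrite tmul0r.
by rewrite tmulDl IHx tmul_pure !mulr1.
Qed.

HB.instance Definition _ :=
  GRing.Zmodule_isPzRing.Build tensor tmulA tmul1r tmulr1 tmulDl tmulDr.

Lemma tpureM a b a' b' : tpure a b * tpure a' b' = tpure (a * a') (b * b').
Proof. exact: tmul_pure. Qed.

Lemma tensor_scalerAl c (x y : tensor) : c *: (x * y) = (c *: x) * y.
Proof.
elim/tensor_ind: x => [|a b x IHx]; first by rewrite !(mul0r, scaler0).
rewrite mulrDl !scalerDr mulrDl IHx; congr (_ + _).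
elim/tensor_ind: y {IHx} => [|a' b' y IHy]; first by rewrite !(mulr0, scaler0).
by rewrite !mulrDr scalerDr IHy -tpureZl !tpureM -tpureZl scalerAl.
Qed.
Lemma tensor_scalerAr c (x y : tensor) : c *: (x * y) = x * (c *: y).
Proof.
elim/tensor_ind: x => [|a b x IHx]; first by rewrite !(mul0r, scaler0).
rewrite !mulrDl !scalerDr IHx; congr (_ + _).
elim/tensor_ind: y {IHx} => [|a' b' y IHy]; first by rewrite !(mulr0, scaler0).
by rewrite scalerDr !mulrDr scalerDr IHy -tpureZl !tpureM -tpureZl scalerAr.
Qed.

Section Lift.
Variables (V : zmodType) (f : A -> B -> V).
Hypotheses (fDl : forall a a' b, f (a + a') b = f a b + f a' b)
           (fDr : forall a b b', f a (b + b') = f a b + f a b')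
           (fZ : forall c a b, f (c *: a) b = f a (c *: b)).

Definition tensor_lift (x : tensor) : V :=
  \sum_(p <- tensor_repr x) f p.1 p.2.

Lemma tensor_lift_eq s t : tensor_eq s t ->
  \sum_(p <- s) f p.1 p.2 = \sum_(p <- t) f p.1 p.2.
Proof.
elim=> {s t} //.
- by move=> s t u _ -> _ ->.
- by move=> s s' t t' _ ss' _ tt'; rewrite !big_cat /= ss' tt'.
- by move=> s t; rewrite !big_cat /= addrC.
- by move=> b; rewrite big_seq1 big_nil; apply: (addrI (f 0 b)); rewrite -fDl !addr0.
- by move=> a a' b; rewrite !big_cons !big_nil !addr0 fDl.
- by move=> a b b'; rewrite !big_cons !big_nil !addr0 fDr.
- by move=> c a b; rewrite !big_seq1 fZ.
Qed.

Lemma tensor_lift_pure a b : tensor_lift (tpure a b) = f a b.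
Proof. by rewrite /tensor_lift (tensor_lift_eq (tensor_piK _)) big_seq1. Qed.
Lemma tensor_lift0 : tensor_lift 0 = 0.
Proof. by rewrite /tensor_lift (tensor_lift_eq (tensor_piK _)) big_nil. Qed.
Lemma tensor_liftD : {morph tensor_lift : x y / x + y}.
Proof.
by move=> x y; rewrite /tensor_lift (tensor_lift_eq (tensor_piK _)) big_cat.
Qed.
End Lift.

End Tensor.

Notation "a \ox b" := (tpure a b) : ring_scope.

Section Uq.
Variables (R : realType) (q : R).
Local Notation C := R[i].

Inductive Uq_expr : Type :=
| UK | UKinv | UE | UF
| UCst of C
| UAdd of Uq_expr & Uq_expr
| UMul of Uq_expr & Uq_expr.

(* The smallest congruence containing the axioms of unital associative
   C-algebras and the four groups of defining relations. *)
Inductive Uq_eq : Uq_expr -> Uq_expr -> Prop :=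
| Ueq_refl s : Uq_eq s s
| Ueq_sym s t : Uq_eq s t -> Uq_eq t s
| Ueq_trans s t u : Uq_eq s t -> Uq_eq t u -> Uq_eq s u
| Ueq_add s s' t t' : Uq_eq s s' -> Uq_eq t t' -> Uq_eq (UAdd s t) (UAdd s' t')
| Ueq_mul s s' t t' : Uq_eq s s' -> Uq_eq t t' -> Uq_eq (UMul s t) (UMul s' t')
| Ueq_addA s t u : Uq_eq (UAdd s (UAdd t u)) (UAdd (UAdd s t) u)
| Ueq_addC s t : Uq_eq (UAdd s t) (UAdd t s)
| Ueq_add0 s : Uq_eq (UAdd (UCst 0) s) s
| Ueq_addN s : Uq_eq (UAdd (UMul (UCst (-1)) s) s) (UCst 0)
| Ueq_mulA s t u : Uq_eq (UMul s (UMul t u)) (UMul (UMul s t) u)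
| Ueq_mul1 s : Uq_eq (UMul (UCst 1) s) s
| Ueq_mulDl s t u : Uq_eq (UMul (UAdd s t) u) (UAdd (UMul s u) (UMul t u))
| Ueq_mulDr s t u : Uq_eq (UMul s (UAdd t u)) (UAdd (UMul s t) (UMul s u))
| Ueq_cstD c d : Uq_eq (UCst (c + d)) (UAdd (UCst c) (UCst d))
| Ueq_cstM c d : Uq_eq (UCst (c * d)) (UMul (UCst c) (UCst d))
| Ueq_cstC c s : Uq_eq (UMul (UCst c) s) (UMul s (UCst c))
| Ueq_KKinv : Uq_eq (UMul UK UKinv) (UCst 1)
| Ueq_KinvK : Uq_eq (UMul UKinv UK) (UCst 1)
| Ueq_KE : Uq_eq (UMul UK UE) (UMul (UCst q%:C) (UMul UE UK))
| Ueq_KF : Uq_eq (UMul UK UF) (UMul (UCst (q^-1)%:C) (UMul UF UK))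
| Ueq_EF :
    Uq_eq (UAdd (UMul UE UF) (UMul (UCst (-1)) (UMul UF UE)))
          (UMul (UCst ((q - q^-1)^-1)%:C)
             (UAdd (UMul UK UK) (UMul (UCst (-1)) (UMul UKinv UKinv)))).

HB.instance Definition _ := gen_eqMixin Uq_expr.
HB.instance Definition _ := gen_choiceMixin Uq_expr.

Definition Uq_eqb (s t : Uq_expr) : bool := `[< Uq_eq s t >].

Fact Uq_eqb_refl : reflexive Uq_eqb.
Proof. by move=> s; apply/asboolP; apply: Ueq_refl. Qed.
Fact Uq_eqb_sym : symmetric Uq_eqb.
Proof. by move=> s t; apply/asboolP/asboolP; apply: Ueq_sym. Qed.
Fact Uq_eqb_trans : transitive Uq_eqb.
Proof.
by move=> t s u /asboolP st /asboolP tu; apply/asboolP; apply: Ueq_trans tu.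
Qed.

Canonical Uq_equiv := EquivRel Uq_eqb Uq_eqb_refl Uq_eqb_sym Uq_eqb_trans.

Definition Uq : Type := {eq_quot Uq_equiv}.
HB.instance Definition _ := Choice.on Uq.

Definition Uq_pi (s : Uq_expr) : Uq := \pi_{eq_quot Uq_equiv} s.
Definition Uq_repr (x : Uq) : Uq_expr := repr (x : {eq_quot Uq_equiv}).

Lemma Uq_reprK x : Uq_pi (Uq_repr x) = x.
Proof. exact: reprK. Qed.

Lemma Uq_piP s t : Uq_pi s = Uq_pi t <-> Uq_eq s t.
Proof.
split=> [/eqmodP /asboolP //|st].
by apply/eqmodP/asboolP.
Qed.

Lemma Uq_piK s : Uq_eq (Uq_repr (Uq_pi s)) s.
Proof. by apply/Uq_piP; rewrite Uq_reprK. Qed.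

Definition Uq_add (x y : Uq) := Uq_pi (UAdd (Uq_repr x) (Uq_repr y)).
Definition Uq_mul (x y : Uq) := Uq_pi (UMul (Uq_repr x) (Uq_repr y)).
Definition Uq_cst (c : C) : Uq := Uq_pi (UCst c).
Definition Uq_scale (c : C) (x : Uq) := Uq_mul (Uq_cst c) x.
Definition Uq_opp (x : Uq) := Uq_scale (-1) x.

Lemma Uq_add_pi s t : Uq_add (Uq_pi s) (Uq_pi t) = Uq_pi (UAdd s t).
Proof. by apply/Uq_piP; apply: Ueq_add; apply: Uq_piK. Qed.
Lemma Uq_mul_pi s t : Uq_mul (Uq_pi s) (Uq_pi t) = Uq_pi (UMul s t).
Proof. by apply/Uq_piP; apply: Ueq_mul; apply: Uq_piK. Qed.

Let piE := (Uq_add_pi, Uq_mul_pi).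
#[local] Opaque Uq_add Uq_mul.

Lemma Uq_addA : associative Uq_add.
Proof.
move=> x y z; rewrite -[x]Uq_reprK -[y]Uq_reprK -[z]Uq_reprK !piE.
by apply/Uq_piP; apply: Ueq_addA.
Qed.
Lemma Uq_addC : commutative Uq_add.
Proof.
move=> x y; rewrite -[x]Uq_reprK -[y]Uq_reprK !piE.
by apply/Uq_piP; apply: Ueq_addC.
Qed.
Lemma Uq_add0 : left_id (Uq_cst 0) Uq_add.
Proof.
by move=> x; rewrite -[x]Uq_reprK !piE; apply/Uq_piP; apply: Ueq_add0.
Qed.
Lemma Uq_addN : left_inverse (Uq_cst 0) Uq_opp Uq_add.
Proof.
move=> x; rewrite -[x]Uq_reprK /Uq_opp /Uq_scale /Uq_cst !piE.
by apply/Uq_piP; apply: Ueq_addN.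
Qed.

HB.instance Definition _ :=
  GRing.isZmodule.Build Uq Uq_addA Uq_addC Uq_add0 Uq_addN.

Lemma Uq_pi_add s t : Uq_pi (UAdd s t) = Uq_pi s + Uq_pi t.
Proof. by rewrite -Uq_add_pi. Qed.

Lemma Uq_mulA : associative Uq_mul.
Proof.
move=> x y z; rewrite -[x]Uq_reprK -[y]Uq_reprK -[z]Uq_reprK !piE.
by apply/Uq_piP; apply: Ueq_mulA.
Qed.
Lemma Uq_mul1r : left_id (Uq_cst 1) Uq_mul.
Proof.
by move=> x; rewrite -[x]Uq_reprK !piE; apply/Uq_piP; apply: Ueq_mul1.
Qed.
Lemma Uq_cstC c x : Uq_mul (Uq_cst c) x = Uq_mul x (Uq_cst c).
Proof.
by rewrite -[x]Uq_reprK !piE; apply/Uq_piP; apply: Ueq_cstC.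
Qed.
Lemma Uq_mulr1 : right_id (Uq_cst 1) Uq_mul.
Proof. by move=> x; rewrite -Uq_cstC Uq_mul1r. Qed.
Lemma Uq_mulDl : left_distributive Uq_mul +%R.
Proof.
move=> x y z; rewrite -[x]Uq_reprK -[y]Uq_reprK -[z]Uq_reprK -Uq_pi_add !piE.
by rewrite -Uq_pi_add; apply/Uq_piP; apply: Ueq_mulDl.
Qed.
Lemma Uq_mulDr : right_distributive Uq_mul +%R.
Proof.
move=> x y z; rewrite -[x]Uq_reprK -[y]Uq_reprK -[z]Uq_reprK -Uq_pi_add !piE.
by rewrite -Uq_pi_add; apply/Uq_piP; apply: Ueq_mulDr.
Qed.

Lemma Uq_cstM c d : Uq_mul (Uq_cst c) (Uq_cst d) = Uq_cst (c * d).
Proof. by rewrite piE; apply/Uq_piP; apply: Ueq_sym; apply: Ueq_cstM. Qed.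
Lemma Uq_cstD c d : Uq_cst (c + d) = Uq_cst c + Uq_cst d.
Proof. by rewrite -Uq_pi_add; apply/Uq_piP; apply: Ueq_cstD. Qed.

Fixpoint Uq_eval (T : algType C) (k ki e f : T) (s : Uq_expr) : T :=
  match s with
  | UK => k | UKinv => ki | UE => e | UF => f
  | UCst c => c%:A
  | UAdd s t => Uq_eval k ki e f s + Uq_eval k ki e f t
  | UMul s t => Uq_eval k ki e f s * Uq_eval k ki e f t
  end.

Definition Uq_relations (T : algType C) (k ki e f : T) : Prop :=
  [/\ k * ki = 1, ki * k = 1, k * e = q%:C *: (e * k),
      k * f = (q^-1)%:C *: (f * k) &
      e * f - f * e = ((q - q^-1)^-1)%:C *: (k ^+ 2 - ki ^+ 2)].

Lemma Uq_eval_eq (T : algType C) (k ki e f : T) s t :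
  Uq_relations k ki e f -> Uq_eq s t ->
  Uq_eval k ki e f s = Uq_eval k ki e f t.
Proof.
move=> [rKKi rKiK rKE rKF rEF]; elim=> {s t} //=.
- by move=> s t u _ -> _ ->.
- by move=> s s' t t' _ -> _ ->.
- by move=> s s' t t' _ -> _ ->.
- by move=> s t u; rewrite addrA.
- by move=> s t; rewrite addrC.
- by move=> s; rewrite scale0r add0r.
- by move=> s; rewrite mulr_algl scaleN1r addNr scale0r.
- by move=> s t u; rewrite mulrA.
- by move=> s; rewrite scale1r mul1r.
- by move=> s t u; rewrite mulrDl.
- by move=> s t u; rewrite mulrDr.
- by move=> c d; rewrite scalerDl.
- by move=> c d; rewrite mulr_algl scalerA.
- by move=> c s; rewrite mulr_algl mulr_algr.
- by rewrite scale1r.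
- by rewrite scale1r.
- by rewrite mulr_algl.
- by rewrite mulr_algl.
- by rewrite !mulr_algl !scaleN1r -!expr2.
Qed.

Lemma Uq_counit_relations : Uq_relations (1 : C^o) 1 0 0.
Proof.
by split; rewrite ?mulr1 ?mulr0 ?mul0r ?scaler0 ?subrr ?scaler0.
Qed.

Lemma Uq_oner_neq0 : Uq_cst 1 != 0.
Proof.
apply/eqP => /Uq_piP /(Uq_eval_eq Uq_counit_relations) /eqP /=.
by rewrite scale1r scale0r oner_eq0.
Qed.

HB.instance Definition _ := GRing.Zmodule_isNzRing.Build Uq
  Uq_mulA Uq_mul1r Uq_mulr1 Uq_mulDl Uq_mulDr Uq_oner_neq0.

Lemma Uq_scaleA c d x : Uq_scale c (Uq_scale d x) = Uq_scale (c * d) x.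
Proof. by rewrite /Uq_scale Uq_mulA Uq_cstM. Qed.
Lemma Uq_scale1 : left_id 1 Uq_scale.
Proof. exact: Uq_mul1r. Qed.
Lemma Uq_scaleDr : right_distributive Uq_scale +%R.
Proof. by move=> c x y; apply: Uq_mulDr. Qed.
Lemma Uq_scaleDl x : {morph Uq_scale^~ x : c d / c + d}.
Proof. by move=> c d; rewrite /Uq_scale Uq_cstD Uq_mulDl. Qed.

HB.instance Definition _ := GRing.Zmodule_isLmodule.Build C Uq
  Uq_scaleA Uq_scale1 Uq_scaleDr Uq_scaleDl.

Lemma Uq_scalerAl c (x y : Uq) : c *: (x * y) = (c *: x) * y.
Proof. exact: Uq_mulA. Qed.
HB.instance Definition _ := GRing.Lmodule_isLalgebra.Build C Uq Uq_scalerAl.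

Lemma Uq_scalerAr c (x y : Uq) : c *: (x * y) = x * (c *: y).
Proof.
rewrite [LHS]Uq_mulA [Uq_mul _ x]Uq_cstC.
exact/esym/Uq_mulA.
Qed.
HB.instance Definition _ := GRing.Lalgebra_isAlgebra.Build C Uq Uq_scalerAr.

Definition Khat : Uq := Uq_pi UK.
Definition Khat_inv : Uq := Uq_pi UKinv.
Definition Ehat : Uq := Uq_pi UE.
Definition Fhat : Uq := Uq_pi UF.

Lemma Uq_pi_mul s t : Uq_pi (UMul s t) = Uq_pi s * Uq_pi t.
Proof. by rewrite -Uq_mul_pi. Qed.
Lemma Uq_pi_cst c : Uq_pi (UCst c) = c%:A.
Proof. by rewrite -[LHS]mulr1. Qed.

Lemma Uq_generators_relations : Uq_relations Khat Khat_inv Ehat Fhat.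
Proof.
rewrite /Khat /Khat_inv /Ehat /Fhat; split.
- by rewrite -Uq_pi_mul; apply/Uq_piP; apply: Ueq_KKinv.
- by rewrite -Uq_pi_mul; apply/Uq_piP; apply: Ueq_KinvK.
- by rewrite -!Uq_pi_mul -mulr_algl -Uq_pi_cst -Uq_pi_mul; apply/Uq_piP; apply: Ueq_KE.
- by rewrite -!Uq_pi_mul -mulr_algl -Uq_pi_cst -Uq_pi_mul; apply/Uq_piP; apply: Ueq_KF.
- rewrite !expr2 -!Uq_pi_mul.
  have piN s : - Uq_pi s = Uq_pi (UMul (UCst (-1)) s).
    by rewrite Uq_pi_mul Uq_pi_cst mulr_algl scaleN1r.
  rewrite !piN -!Uq_pi_add -mulr_algl -Uq_pi_cst -Uq_pi_mul.
  by apply/Uq_piP; apply: Ueq_EF.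
Qed.

Section Lift.
Variables (T : algType C) (k ki e f : T) (H : Uq_relations k ki e f).

Definition Uq_lift of Uq_relations k ki e f :=
  fun x : Uq => Uq_eval k ki e f (Uq_repr x).

Local Notation phi := (Uq_lift H).

Lemma Uq_lift_pi s : phi (Uq_pi s) = Uq_eval k ki e f s.
Proof. exact: Uq_eval_eq (Uq_piK s). Qed.

Lemma Uq_lift_linear : linear phi.
Proof.
move=> c x y; rewrite -[x]Uq_reprK -[y]Uq_reprK.
rewrite -[c *: _]mulr_algl -Uq_pi_cst -Uq_pi_mul -Uq_pi_add !Uq_lift_pi /=.
by rewrite mulr_algl.
Qed.
Lemma Uq_lift_monoid_morphism : monoid_morphism phi.
Proof.
split; first by rewrite (Uq_lift_pi (UCst 1)) /= scale1r.
move=> x y; rewrite -[x]Uq_reprK -[y]Uq_reprK.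
by rewrite -Uq_pi_mul !Uq_lift_pi.
Qed.

HB.instance Definition _ := GRing.isLinear.Build C Uq T _ phi Uq_lift_linear.
HB.instance Definition _ :=
  GRing.isMonoidMorphism.Build Uq T phi Uq_lift_monoid_morphism.

Lemma Uq_lift_K : phi Khat = k. Proof. exact: Uq_lift_pi. Qed.
Lemma Uq_lift_Kinv : phi Khat_inv = ki. Proof. exact: Uq_lift_pi. Qed.
Lemma Uq_lift_E : phi Ehat = e. Proof. exact: Uq_lift_pi. Qed.
Lemma Uq_lift_F : phi Fhat = f. Proof. exact: Uq_lift_pi. Qed.
End Lift.

Definition Uq2 : Type := tensor Uq Uq.
HB.instance Definition _ := GRing.PzRing.on Uq2.
HB.instance Definition _ := GRing.Lmodule.on Uq2.

Lemma Uq2_oner_neq0 : (1 : Uq2) != 0.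
Proof.
pose eps : {lrmorphism Uq -> C^o} := Uq_lift Uq_counit_relations.
pose f (a b : Uq) : C^o := eps a * eps b.
have fDl a a' b : f (a + a') b = f a b + f a' b by rewrite /f raddfD mulrDl.
have fDr a b b' : f a (b + b') = f a b + f a b' by rewrite /f raddfD mulrDr.
have fZ c a b : f (c *: a) b = f a (c *: b).
  by rewrite /f !linearZ /= -scalerAl -scalerAr.
apply/eqP => /(congr1 (tensor_lift f)).
rewrite (tensor_lift0 fDl fDr fZ) (tensor_lift_pure fDl fDr fZ) /f rmorph1 mulr1.
by move/eqP; rewrite oner_eq0.
Qed.

HB.instance Definition _ := GRing.PzSemiRing_isNonZero.Build Uq2 Uq2_oner_neq0.
HB.instance Definition _ := GRing.Lmodule_isLalgebra.Build C Uq2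
  (@tensor_scalerAl C Uq Uq).
HB.instance Definition _ := GRing.Lalgebra_isAlgebra.Build C Uq2
  (@tensor_scalerAr C Uq Uq).

Definition Delta_K : Uq2 := Khat \ox Khat.
Definition Delta_Kinv : Uq2 := Khat_inv \ox Khat_inv.
Definition Delta_E : Uq2 := Khat \ox Ehat + Ehat \ox Khat_inv.
Definition Delta_F : Uq2 := Khat \ox Fhat + Fhat \ox Khat_inv.

(* No hypothesis on q is needed: for q = 0 the relations force E = F = 0. *)
Lemma Delta_relations : Uq_relations Delta_K Delta_Kinv Delta_E Delta_F.
Proof.
have [KKi KiK KE KF EF] := Uq_generators_relations.
have tM (a b a' b' : Uq) : (a \ox b : Uq2) * (a' \ox b') = (a * a') \ox (b * b').
  exact: tpureM.
have tZl c (a b : Uq) : (c *: a) \ox b = c *: (a \ox b : Uq2) by exact: tpureZl.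
have tZr c (a b : Uq) : a \ox (c *: b) = c *: (a \ox b : Uq2) by exact: tpureZr.
rewrite /Delta_K /Delta_Kinv /Delta_E /Delta_F; split.
- by rewrite tM KKi.
- by rewrite tM KiK.
- by rewrite mulrDl mulrDr !tM KE tZl tZr -scalerDr KKi KiK.
- by rewrite mulrDl mulrDr !tM KF tZl tZr -scalerDr KKi KiK.
have EKi : Ehat * Khat_inv = q%:C *: (Khat_inv * Ehat).
  rewrite -[Ehat in LHS]mul1r -KiK -(mulrA Khat_inv) KE -scalerAr -scalerAl.
  by rewrite -!mulrA KKi mulr1.
have FKi : Fhat * Khat_inv = (q^-1)%:C *: (Khat_inv * Fhat).
  rewrite -[Fhat in LHS]mul1r -KiK -(mulrA Khat_inv) KF -scalerAr -scalerAl.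
  by rewrite -!mulrA KKi mulr1.
have cross1 : (Khat * Fhat) \ox (Ehat * Khat_inv) =
              (Fhat * Khat) \ox (Khat_inv * Ehat) :> Uq2.
  have [q0|q0] := eqVneq q 0; last first.
    by rewrite KF EKi tZl tZr scalerA -rmorphM /= mulVf // scale1r.
  have F0 : Fhat = 0.
    by rewrite -[Fhat]mul1r -KiK -mulrA KF q0 invr0 scale0r mulr0.
  by rewrite F0 mulr0 mul0r -(scale0r 0) !tZl !scale0r.
have cross2 : (Ehat * Khat) \ox (Khat_inv * Fhat) =
              (Khat * Ehat) \ox (Fhat * Khat_inv) :> Uq2.
  have [q0|q0] := eqVneq q 0; last first.
    by rewrite KE FKi tZl tZr scalerA -rmorphM /= mulfV // scale1r.
  have E0 : Ehat = 0.
    by rewrite -[Ehat]mul1r -KiK -mulrA KE q0 scale0r mulr0.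
  by rewrite E0 mulr0 mul0r -(scale0r 0) !tZl !scale0r.
have tBl (a a' b : Uq) : (a - a') \ox b = a \ox b - (a' \ox b) :> Uq2.
  by rewrite -scaleN1r [LHS]tpureDl tZl scaleN1r.
have tBr (a b b' : Uq) : a \ox (b - b') = a \ox b - (a \ox b') :> Uq2.
  by rewrite -scaleN1r [LHS]tpureDr tZr scaleN1r.
rewrite !mulrDl !mulrDr !tM cross1 cross2.
set x := _ \ox _; set y := (Fhat * Khat) \ox _.
set z := (Khat * Ehat) \ox _; set w := (Ehat * Fhat) \ox _.
set x' := (Khat * Khat) \ox (Fhat * Ehat); set w' := (Fhat * Ehat) \ox _.
have -> : x + y + (z + w) - (x' + z + (y + w')) = (x - x') + (w - w').
  rewrite [z + w]addrC addrACA [y + z]addrC [y + w']addrC (addrACA x').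
  by rewrite opprD (addrACA (x + w)) subrr addr0 opprD addrACA.
rewrite -tBl -tBr !EF tZl tZr -scalerDr; congr (_ *: _).
by rewrite tBl tBr addrA subrK !expr2 !tM.
Qed.

Definition Delta : Uq -> Uq2 := Uq_lift Delta_relations.
HB.instance Definition _ := GRing.LRMorphism.on Delta.

Lemma Delta_generators :
  [/\ Delta Khat = Khat \ox Khat, Delta Khat_inv = Khat_inv \ox Khat_inv,
      Delta Ehat = Khat \ox Ehat + Ehat \ox Khat_inv &
      Delta Fhat = Khat \ox Fhat + Fhat \ox Khat_inv].
Proof.
by rewrite /Delta Uq_lift_K Uq_lift_Kinv Uq_lift_E Uq_lift_F.
Qed.

Definition sinhq (x : R) : C := (q `^ x - q `^ (- x))%:C.
Definition coshq (x : R) : C := (q `^ x + q `^ (- x))%:C.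

Definition Omega : Uq :=
  (q^-1)%:C *: Khat ^+ 2 + q%:C *: Khat_inv ^+ 2
  + sinhq 1 ^+ 2 *: (Ehat * Fhat).

Definition AW (T : algType C) (K L A0 A1 A2 A3 A4 A5 : T) : Prop :=
  coshq 2 *: (K * L * K) - K ^+ 2 * L - L * K ^+ 2
    = sinhq 1 ^+ 2 *: ((A0 * A1 - A2 * A3) * K) - coshq 1 ^+ 2 *: (A5 * L)
      + coshq 1 *: (A1 * A3 * A5 + sinhq 1 ^+ 2 *: (A0 * A2))
  /\
  coshq 2 *: (L * K * L) - L ^+ 2 * K - K * L ^+ 2
    = sinhq 1 ^+ 2 *: ((A0 * A1 - A2 * A3) * L) - coshq 1 ^+ 2 *: (A4 * K)
      + coshq 1 *: (A0 * A3 * A4 + sinhq 1 ^+ 2 *: (A1 * A2)).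

Definition Y_K (aE aF as_ : C) : Uq :=
  ((q `^ 2^-1)%:C * aE) *: (Ehat * Khat)
  + ((q `^ (- 2^-1))%:C * aF) *: (Fhat * Khat)
  + as_ *: Khat ^+ 2.

Definition Y_L (bE bF bt : C) : Uq :=
  ((q `^ (- 2^-1))%:C * bE) *: (Ehat * Khat_inv)
  + ((q `^ 2^-1)%:C * bF) *: (Fhat * Khat_inv)
  + bt *: Khat_inv ^+ 2.

Definition theta (aE aF bE bF : C) : C :=
  - sinhq 1 ^- 2 * (aE * bF + aF * bE).

End Uq.

Arguments Khat {R q}.
Arguments Khat_inv {R q}.
Arguments Ehat {R q}.
Arguments Fhat {R q}.

#[global] Opaque tadd tscale tmul Uq_add Uq_mul.

(* Main.v *)
Require Import Defs.
From HB Require Import structures.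
From mathcomp Require Import all_boot all_order all_algebra.
From mathcomp Require Import complex.
From mathcomp Require Import reals exp.
From mathcomp Require Import ring.

Import Order.TTheory GRing.Theory Num.Theory.
Local Open Scope ring_scope.
Local Open Scope complex_scope.

(** Every assertion is an identity between explicit elements of [Uq (x) Uq], so
    it can be decided by rewriting both sides as combinations of the PBW
    monomials [K^n F^f E^e (x) K^n' F^f' E^e'].  Put [s = q - q^-1],
    [E' = s E] and [F' = s F], and divide [aE], [aF], [bE], [bF] by [s].  Then
    [E' F' - F' E' = s (K^2 - K^-2)], [Omega = q^-1 K^2 + q K^-2 + E' F'] and
    [theta = - (aE' bF' + aF' bE')]: no denominator is left, and all
    coefficients are integral Laurent polynomials in [q^(1/2)] and the six
    parameters.  The normal form is computed by letting expressions act on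
    such combinations from the left, one generator at a time. *)

(** * Formal combinations of PBW monomials and the left action of expressions *)

Variant gen := GK | GKinv | GE | GF.

(* [(n, (f, e))] stands for [K^n F'^f E'^e]. *)
Definition pbw : Type := int * (nat * nat).

(* [(z, ((n, u), (m1, m2)))] stands for [z * p^n * \prod_(i <- u) c_i] times
   [m1 (x) m2], where [p = q^(1/2)] and [c_i] is the [i]-th parameter. *)
Definition monom : Type := (int * seq nat) * (pbw * pbw).
Definition tpoly : Type := seq (int * monom).

(* [XCst z n u] is the scalar [z * p^n * \prod_(i <- u) c_i]; [XGen b g] is the
   generator [g] in the left ([b = false]) or right ([b = true]) factor. *)
Inductive expr : Type :=
| XCst of int & int & seq nat
| XGen of bool & gen
| XAdd of expr & expr
| XMul of expr & expr.

Declare Scope expr_scope.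
Bind Scope expr_scope with expr.
Delimit Scope expr_scope with X.
Notation "x + y" := (XAdd x y) : expr_scope.
Notation "x * y" := (XMul x y) : expr_scope.
Notation "- x" := (XMul (XCst (-1) 0 [::]) x) : expr_scope.
Notation "x - y" := (XAdd x (- y)%X) : expr_scope.

(* The last four terms for [GE] come from
   [E' F'^f = F'^f E' + (q^(2f-1) - q^-1) K^2 F'^(f-1)
              + (q^(1-2f) - q) K^-2 F'^(f-1)]. *)
Definition gen_act (g : gen) (m : pbw) : seq (int * int * pbw) :=
  let: (n, (f, e)) := m in
  match g with
  | GK => [:: (1, 0, (n + 1, (f, e)))]
  | GKinv => [:: (1, 0, (n - 1, (f, e)))]
  | GF => [:: (1, n *+ 2, (n, (f.+1, e)))]
  | GE => (1, n *- 2, (n, (f, e.+1))) ::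
      if f is f'.+1 then
        [:: (1, n *- 2 + f%:Z *+ 4 - 2, (n + 2, (f', e)));
            (-1, n *- 2 - 2, (n + 2, (f', e)));
            (1, n *- 2 - f%:Z *+ 4 + 2, (n - 2, (f', e)));
            (-1, n *- 2 + 2, (n - 2, (f', e)))]
      else [::]
  end.

Definition term_act (b : bool) (g : gen) (t : int * monom) : tpoly :=
  let: (z, ((n, u), (m1, m2))) := t in
  [seq (z * v.1.1, ((n + v.1.2, u), if b then (m1, v.2) else (v.2, m2)))
     | v <- gen_act g (if b then m2 else m1)].

Fixpoint add_term (t : int * monom) (v : tpoly) : tpoly :=
  if v is u :: v' then
    if t.2 == u.2 then (t.1 + u.1, u.2) :: v' else u :: add_term t v'
  else [:: t].

Definition collect (v : tpoly) : tpoly :=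
  [seq t <- foldr add_term [::] v | t.1 != 0].

(** Parameters are scalars and commute, so their index lists are kept sorted: equal monomials are
    then syntactically equal, which is what [add_term] tests. Collecting between the two factors of
    a product keeps the intermediate combinations short. *)
Fixpoint act (x : expr) (v : tpoly) : tpoly :=
  match x with
  | XCst z n u =>
      [seq (z * t.1, ((n + t.2.1.1, sort leq (u ++ t.2.1.2)), t.2.2)) | t <- v]
  | XGen b g => flatten [seq term_act b g t | t <- v]
  | XAdd x y => act x v ++ act y v
  | XMul x y => act x (collect (act y v))
  end.

Definition tpoly1 : tpoly :=
  [:: (1, ((0, [::]), ((0, (0%N, 0%N)), (0, (0%N, 0%N)))))].

Definition vanishes (x : expr) : bool := nilp (collect (act x tpoly1)).

(** * Soundness: the computed action is left multiplication in [Uq2 q] *)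

Lemma qcommX {F : comNzRingType} {A : algType F} {x y : A} {d : F} m :
  x * y = d *: (y * x) -> x * y ^+ m = d ^+ m *: (y ^+ m * x).
Proof.
move=> xy; elim: m => [|m IHm]; first by rewrite scale1r mulr1 mul1r.
by rewrite !exprS [LHS]mulrA xy -scalerAl -(mulrA y x) IHm -scalerAr scalerA mulrA.
Qed.

Section Soundness.
Variables (R : realType) (q : R) (p : R[i]) (c : nat -> R[i]).
Hypotheses (p_neq0 : p != 0) (p2E : p ^+ 2 = q%:C).
Hypothesis q2_neq0 : q - q^-1 != 0.

Let s : R[i] := p ^+ 2 - p ^- 2.

Definition gen_eval (g : gen) : Uq q :=
  match g with
  | GK => Khat | GKinv => Khat_inv | GE => s *: Ehat | GF => s *: Fhat
  end.

(** [Negz m] is the integer -(m + 1), hence the exponent [m.+1] of [Khat_inv]. *)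
Definition Kpow (n : int) : Uq q :=
  match n with Posz m => Khat ^+ m | Negz m => Khat_inv ^+ m.+1 end.

Definition pbw_eval (m : pbw) : Uq q :=
  Kpow m.1 * gen_eval GF ^+ m.2.1 * gen_eval GE ^+ m.2.2.

Definition coef_eval (z n : int) (u : seq nat) : R[i] :=
  z%:~R * p ^ n * \prod_(i <- u) c i.

Definition term_eval (t : int * monom) : Uq2 q :=
  coef_eval t.1 t.2.1.1 t.2.1.2 *: (pbw_eval t.2.2.1 \ox pbw_eval t.2.2.2).

Definition tpoly_eval (v : tpoly) : Uq2 q := \sum_(t <- v) term_eval t.

Fixpoint eval (x : expr) : Uq2 q :=
  match x with
  | XCst z n u => (coef_eval z n u)%:A
  | XGen b g => if b then 1 \ox gen_eval g else gen_eval g \ox 1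
  | XAdd x y => eval x + eval y
  | XMul x y => eval x * eval y
  end.

Lemma sE : s = (q - q^-1)%:C.
Proof. by rewrite /s p2E [RHS]rmorphB /= fmorphV. Qed.

Lemma KpowS n : Khat * Kpow n = Kpow (n + 1).
Proof.
have [KKi _ _ _ _] := Uq_generators_relations q.
case: n => [m|[|m]] /=; first by rewrite -exprS addn1.
- by rewrite expr1 KKi.
- by rewrite exprS mulrA KKi mul1r subn1.
Qed.

Lemma KpowP n : Khat_inv * Kpow n = Kpow (n - 1).
Proof.
have [_ KiK _ _ _] := Uq_generators_relations q.
by rewrite -[in LHS](subrK 1 n) -KpowS mulrA KiK mul1r.
Qed.

(** Multiplying the hypothesis by K^-1 on both sides shows that x passes K^-1 with factor d^-1;
    [qcommX] then handles each sign of n. *)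
Lemma mul_Kpow {x : Uq q} {d : R[i]} n : d != 0 ->
  x * Khat = d *: (Khat * x) -> x * Kpow n = d ^ n *: (Kpow n * x).
Proof.
move=> d0 xK; have [KKi KiK _ _ _] := Uq_generators_relations q.
have xKi : x * Khat_inv = d^-1 *: (Khat_inv * x).
  apply: (can_inj (scalerK d0)); rewrite scalerA mulfV // scale1r.
  rewrite -[X in X * Khat_inv]mul1r -KiK -2!mulrA scalerAr; congr (_ * _).
  by rewrite mulrA scalerAl -xK -mulrA KKi mulr1.
by case: n => m; rewrite /= ?(qcommX _ xK) // (qcommX _ xKi) NegzE -exprz_inv.
Qed.

Lemma F_Kpow n : gen_eval GF * Kpow n = p ^ (n *+ 2) *: (Kpow n * gen_eval GF).
Proof.
have [_ _ _ KF _] := Uq_generators_relations q.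
have -> : p ^ (n *+ 2) = (p ^+ 2) ^ n by rewrite -mulr_natl -exprz_exp.
apply: mul_Kpow; first exact: expf_neq0.
rewrite /= -scalerAl -scalerAr KF !scalerA p2E mulrAC -rmorphM mulfV ?mul1r //.
by move: (expf_neq0 2 p_neq0); rewrite p2E fmorph_eq0.
Qed.

Lemma E_Kpow n : gen_eval GE * Kpow n = p ^ (n *- 2) *: (Kpow n * gen_eval GE).
Proof.
have [_ _ KE _ _] := Uq_generators_relations q.
have -> : p ^ (n *- 2) = (p ^- 2) ^ n.
  by rewrite -mulr_natl -mulNr -exprz_exp.
apply: mul_Kpow; first by rewrite invr_eq0 expf_neq0.
rewrite /= -scalerAl -scalerAr KE !scalerA p2E mulrAC mulVf ?mul1r //.
by rewrite -p2E expf_neq0.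
Qed.

Lemma E_F : gen_eval GE * gen_eval GF =
  gen_eval GF * gen_eval GE + s *: (Kpow 2 - Kpow (-2)).
Proof.
have [_ _ _ _ EF] := Uq_generators_relations q.
apply/eqP; rewrite addrC -subr_eq /= -!scalerAl -!scalerAr !scalerA -scalerBr EF.
by rewrite scalerA sE -mulrA -rmorphM /= mulfV // mulr1.
Qed.

(** Moving one more F' past K^2 or K^-2 multiplies the previous coefficient by p^4 or p^-4. The new
    commutator E' F' - F' E' adds s or -s, with s = p^2 - p^-2, and the middle powers of p
    cancel. *)
Lemma E_Fexp f : gen_eval GE * gen_eval GF ^+ f.+1 =
  gen_eval GF ^+ f.+1 * gen_eval GE
  + (p ^ (f.+1%:Z *+ 4 - 2) - p ^ (-2)) *: (Kpow 2 * gen_eval GF ^+ f)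
  + (p ^ (2 - f.+1%:Z *+ 4) - p ^ 2) *: (Kpow (-2) * gen_eval GF ^+ f).
Proof.
elim: f => [|f IHf].
  rewrite !expr1 !expr0 !mulr1 E_F scalerBr -addrA; congr (_ + (_ + _)).
  by rewrite -scaleNr opprB.
have fK n : gen_eval GF * (Kpow n * gen_eval GF ^+ f)
    = p ^ (n *+ 2) *: (Kpow n * gen_eval GF ^+ f.+1).
  by rewrite mulrA F_Kpow -scalerAl -mulrA -exprS.
have regroup (X u v : Uq q) (a b d : R[i]) :
    X + a *: u + b *: v + d *: (u - v) = X + (a + d) *: u + (b - d) *: v.
  by rewrite scalerBr scalerDl scalerBl !addrA; congr (_ - _); rewrite addrAC.
rewrite exprS mulrA E_F mulrDl -mulrA IHf !mulrDr -!scalerAr !fK mulrA -exprS.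
rewrite -scalerAl mulrBl !scalerA regroup; congr (_ + _ *: _ + _ *: _).
- have -> : f.+2%:Z *+ 4 - 2 = f.+1%:Z *+ 4 - 2 + 2 *+ 2.
    by rewrite (intS f.+1); ring.
  by rewrite mulrBl -!expfzDr // /s addrA subrK.
- have -> : 2 - f.+2%:Z *+ 4 = 2 - f.+1%:Z *+ 4 + (- 2) *+ 2.
    by rewrite (intS f.+1); ring.
  by rewrite mulrBl -!expfzDr // /s opprB addrA subrK.
Qed.

Lemma Kpow_add2 n : Kpow n * Kpow 2 = Kpow (n + 2).
Proof.
(* K commutes with its integer powers: [mul_Kpow] with d = 1. *)
have KnK : Khat * Kpow n = Kpow n * Khat.
  by rewrite (mul_Kpow n (oner_neq0 _)) ?scale1r // exp1rz scale1r.
rewrite [Kpow 2]expr2 mulrA -KnK -mulrA -KnK !KpowS.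
by rewrite -addrA.
Qed.

Lemma Kpow_sub2 n : Kpow n * Kpow (-2) = Kpow (n - 2).
Proof.
have [KKi KiK _ _ _] := Uq_generators_relations q.
have KnKi : Khat_inv * Kpow n = Kpow n * Khat_inv.
  by rewrite (mul_Kpow n (oner_neq0 _)) ?scale1r ?KKi ?KiK // exp1rz scale1r.
rewrite [Kpow (-2)]expr2 mulrA -KnKi -mulrA -KnKi !KpowP.
by rewrite -addrA.
Qed.

(** Only E' needs work: passing K^n gives the common factor p^(-2n), and [E_Fexp] gives corrections
    in K^2 and K^-2. Their coefficients are differences of powers of p, hence the four terms in
    [gen_act]. *)
Lemma gen_actP g m : gen_eval g * pbw_eval m =
  \sum_(u <- gen_act g m) (u.1.1%:~R * p ^ u.1.2) *: pbw_eval u.2.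
Proof.
case: m => n [f e]; rewrite /pbw_eval; case: g; rewrite [gen_act _ _]/=.
- by rewrite big_seq1 mul1r expr0z scale1r !mulrA KpowS.
- by rewrite big_seq1 mul1r expr0z scale1r !mulrA KpowP.
(* [Kpow] and [gen_eval] are generalized because [mulrA] would otherwise see
   through the definition of powers and of scaling as products. *)
- have EKn := E_Kpow n; have EFf := E_Fexp f.-1.
  move: (Kpow) (gen_eval GE) (gen_eval GF) EKn EFf (Kpow_add2 n) (Kpow_sub2 n).
  move=> Kp E F EKn EFf KpD KpB.
  have -> : E * (Kp n * F ^+ f * E ^+ e) =
      p ^ (n *- 2) *: (Kp n * (E * F ^+ f) * E ^+ e).
    by rewrite !mulrA EKn -!scalerAl.
  case: f EFf => [_|f /= ->].
    by rewrite big_seq1 /= mul1r !expr0 !mulr1 -mulrA -exprS.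
  rewrite !big_cons big_nil /= !mul1r !mulN1r addr0 !mulrDr !mulrDl.
  rewrite -!scalerAr -!scalerAl !mulrA KpD KpB !scalerDr !scalerA.
  rewrite -!addrA; congr (_ *: _ + _).
    by rewrite -!mulrA -exprS.
  rewrite [RHS]addrA -!scalerDl; congr (_ *: _ + _ *: _).
  - by rewrite mulrBr !expfzDr.
  - by rewrite mulrBr !expfzDr // [p ^ (_ *- 4) * _]mulrC !mulrA.
- have FKn := F_Kpow n; move: (gen_eval GE) (gen_eval GF) FKn => E F FKn.
  rewrite big_seq1 /= mul1r !mulrA FKn -!scalerAl.
  by rewrite -(mulrA _ F) -exprS.
Qed.

Lemma term_actP b g t : tpoly_eval (term_act b g t) = eval (XGen b g) * term_eval t.
Proof.
case: t => z [[n u] [m1 m2]].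
have coefM z' n' : coef_eval (z * z') (n + n') u
    = coef_eval z n u * (z'%:~R * p ^ n').
  by rewrite /coef_eval intrM expfzDr //; ring.
rewrite /tpoly_eval big_map /term_eval /= -scalerAr; case: b => /=.
- rewrite [X in _ *: X]tpureM mul1r gen_actP.
  under eq_bigr do rewrite coefM -scalerA.
  rewrite -scaler_sumr; congr (_ *: _).
  elim/big_rec2: _ => [|i x y _ ->].
    (* A pure tensor with factor 0 vanishes: that 0 is written [0 *: 0] and the scalar is pulled
       out. *)
    by rewrite -[X in _ = _ \ox X](scale0r 0) [RHS]tpureZr scale0r.
  by rewrite [RHS]tpureDr [X in _ = X + _]tpureZr.
- rewrite [X in _ *: X]tpureM mul1r gen_actP.
  under eq_bigr do rewrite coefM -scalerA.
  rewrite -scaler_sumr; congr (_ *: _).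
  elim/big_rec2: _ => [|i x y _ ->].
    by rewrite -[X in _ = X \ox _](scale0r 0) [RHS]tpureZl scale0r.
  by rewrite [RHS]tpureDl [X in _ = X + _]tpureZl.
Qed.

Lemma add_termP t v : tpoly_eval (add_term t v) = term_eval t + tpoly_eval v.
Proof.
rewrite /tpoly_eval; elim: v => [|u v IHv] /=; first by rewrite big_seq1 big_nil addr0.
case: eqP => [tu|_]; rewrite !big_cons; last by rewrite IHv addrCA.
rewrite addrA; congr (_ + _); rewrite /term_eval /= tu -scalerDl /coef_eval.
by rewrite intrD !mulrDl.
Qed.

Lemma collectP v : tpoly_eval (collect v) = tpoly_eval v.
Proof.
transitivity (tpoly_eval (foldr add_term [::] v)).
  rewrite /tpoly_eval big_filter [RHS](bigID (fun t => t.1 != 0)) /=.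
  rewrite [X in _ = _ + X]big1 ?addr0 // => t; rewrite negbK => /eqP t0.
  by rewrite /term_eval t0 /coef_eval !mul0r scale0r.
elim: v => [|t v IHv] //=; rewrite add_termP IHv.
by rewrite /tpoly_eval big_cons.
Qed.

Lemma actP x v : tpoly_eval (act x v) = eval x * tpoly_eval v.
Proof.
elim: x v => [z n u|b g|x IHx y IHy|x IHx y IHy] v.
- rewrite /tpoly_eval /= big_map mulr_algl scaler_sumr.
  apply: eq_bigr => t _; rewrite /term_eval /= scalerA; congr (_ *: _).
  rewrite /coef_eval (perm_big (u ++ t.2.1.2)) ?perm_sort // big_cat /=.
  by rewrite intrM expfzDr //; ring.
- rewrite /tpoly_eval [act _ _]/= big_flatten big_map mulr_sumr.
  by apply: eq_bigr => t _; rewrite -term_actP.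
- by rewrite mulrDl -IHx -IHy /tpoly_eval big_cat.
- by rewrite IHx collectP IHy mulrA.
Qed.

Lemma tpoly1E : tpoly_eval tpoly1 = 1.
Proof.
rewrite /tpoly_eval big_seq1 /term_eval /coef_eval /= big_nil !mulr1 scale1r.
by rewrite /pbw_eval !mulr1.
Qed.

(** Acting on [tpoly1] computes x times 1, and [collect] preserves the value, so an empty result is
    the value 0. *)
Lemma vanishesP x : vanishes x -> eval x = 0.
Proof.
move/nilP => x0; rewrite -[eval x]mulr1 -tpoly1E -actP -collectP x0.
exact: big_nil.
Qed.

End Soundness.

(** * The elements and the AW-relations as expressions *)

Definition xvar (i : nat) : expr := XCst 1 0 [:: i].
Definition xpow (n : int) : expr := XCst 1 n [::].
Definition xsinh1 : expr := xpow 2 - xpow (-2).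
Definition xsinh1sq : expr := xsinh1 * xsinh1.
Definition xcosh1 : expr := xpow 2 + xpow (-2).
Definition xcosh2 : expr := xpow 4 + xpow (-4).

(** One shape serves both AW-relations, the second with K and L exchanged. [S] is the coefficient A0
    A1 - A2 A3, [M] is A5 or A4, and [C] and [W] are the cubic and quadratic parts of the last
    term. *)
Definition xrel (K L S M C W : expr) : expr :=
  xcosh2 * (K * L * K) - K * K * L - L * (K * K)
  - (xsinh1sq * (S * K) - xcosh1 * xcosh1 * (M * L)
     + xcosh1 * (C + xsinh1sq * W)).

Definition xAW (K L A0 A1 A2 A3 A4 A5 : expr) : bool :=
  vanishes (xrel K L (A0 * A1 - A2 * A3) A5 (A1 * A3 * A5) (A0 * A2)) &&
  vanishes (xrel L K (A0 * A1 - A2 * A3) A4 (A0 * A3 * A4) (A1 * A2)).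

Definition xcomm (x y : expr) : bool := vanishes (x * y - y * x).

(* The parameters [c_0, ..., c_5] are [aE / s, aF / s, a_s, bE / s, bF / s, b_t]. *)
Definition xYK (k ki e f : expr) : expr :=
  XCst 1 1 [:: 0%N] * (e * k) + XCst 1 (-1) [:: 1%N] * (f * k)
  + xvar 2 * (k * k).
Definition xYL (k ki e f : expr) : expr :=
  XCst 1 (-1) [:: 3%N] * (e * ki) + XCst 1 1 [:: 4%N] * (f * ki)
  + xvar 5 * (ki * ki).
Definition xOmega (k ki e f : expr) : expr :=
  xpow (-2) * (k * k) + xpow 2 * (ki * ki) + e * f.

Definition xtheta : expr := - (XCst 1 0 [:: 0%N; 4%N] + XCst 1 0 [:: 1%N; 3%N]).
(** The factor [xsinh1sq] restores the s^2 lost by dividing both parameters by s. *)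
Definition xaEaF : expr := xsinh1sq * XCst 1 0 [:: 0%N; 1%N].
Definition xbEbF : expr := xsinh1sq * XCst 1 0 [:: 3%N; 4%N].

Definition xleft (X : expr -> expr -> expr -> expr -> expr) : expr :=
  X (XGen false GK) (XGen false GKinv) (XGen false GE) (XGen false GF).
Definition xright (X : expr -> expr -> expr -> expr -> expr) : expr :=
  X (XGen true GK) (XGen true GKinv) (XGen true GE) (XGen true GF).
Definition xDelta (X : expr -> expr -> expr -> expr -> expr) : expr :=
  X (XGen false GK * XGen true GK)%X (XGen false GKinv * XGen true GKinv)%X
    (XGen false GK * XGen true GE + XGen false GE * XGen true GKinv)%X
    (XGen false GK * XGen true GF + XGen false GF * XGen true GKinv)%X.

(** * The five AW-relations, verified by computing normal forms *)

Lemma xAW_Delta_Delta :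
  xAW (xDelta xYK) (xDelta xYL)
    (xvar 2) (xvar 5) xtheta (xDelta xOmega) xbEbF xaEaF.
Proof. by vm_compute. Qed.

Lemma xAW_right_Delta :
  xAW (xright xYK) (xDelta xYL)
    (xvar 2) (xleft xYL) xtheta (xright xOmega) xbEbF xaEaF.
Proof. by vm_compute. Qed.

Lemma xAW_Delta_left :
  xAW (xDelta xYK) (xleft xYL)
    (xright xYK) (xvar 5) xtheta (xleft xOmega) xbEbF xaEaF.
Proof. by vm_compute. Qed.

Lemma xAW_right_Omega :
  xAW (xright xYK) (xDelta xOmega)
    (xvar 2) (xleft xOmega) (- xDelta xYK) (xright xOmega) (- xsinh1sq) xaEaF.
Proof. by vm_compute. Qed.

Lemma xAW_Omega_left :
  xAW (xDelta xOmega) (xleft xYL)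
    (xright xOmega) (xvar 5) (- xDelta xYL) (xleft xOmega) xbEbF (- xsinh1sq).
Proof. by vm_compute. Qed.

(** * The two embeddings of [Uq q] into [Uq2 q] as algebra morphisms *)

Section Embeddings.
Variables (R : realType) (q : R).

Definition left_tensor (x : Uq q) : Uq2 q := x \ox 1.
Definition right_tensor (x : Uq q) : Uq2 q := 1 \ox x.

Lemma left_tensor_linear : linear left_tensor.
Proof. by move=> d x y; rewrite /left_tensor [LHS]tpureDl [X in X + _]tpureZl. Qed.

Lemma left_tensor_monoid_morphism : monoid_morphism left_tensor.
Proof. by split=> // x y; rewrite /left_tensor [RHS]tpureM mulr1. Qed.

Lemma right_tensor_linear : linear right_tensor.
Proof. by move=> d x y; rewrite /right_tensor [LHS]tpureDr [X in X + _]tpureZr. Qed.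

Lemma right_tensor_monoid_morphism : monoid_morphism right_tensor.
Proof. by split=> // x y; rewrite /right_tensor [RHS]tpureM mulr1. Qed.

HB.instance Definition _ :=
  GRing.isLinear.Build R[i] (Uq q) (Uq2 q) _ left_tensor left_tensor_linear.
HB.instance Definition _ :=
  GRing.isMonoidMorphism.Build (Uq q) (Uq2 q) left_tensor
    left_tensor_monoid_morphism.
HB.instance Definition _ :=
  GRing.isLinear.Build R[i] (Uq q) (Uq2 q) _ right_tensor right_tensor_linear.
HB.instance Definition _ :=
  GRing.isMonoidMorphism.Build (Uq q) (Uq2 q) right_tensor
    right_tensor_monoid_morphism.

End Embeddings.

(** * Evaluation of the expressions at the given q and parameters *)

Section Interpretation.
Variables (R : realType) (q : R) (q_gt0 : 0 < q) (q_lt1 : q < 1).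
Variables aE aF a_s bE bF b_t : R[i].

Let s : R[i] := sinhq q 1.
Let p : R[i] := (q `^ 2^-1)%:C.
Let c (i : nat) : R[i] := [:: aE / s; aF / s; a_s; bE / s; bF / s; b_t]`_i.
Local Notation ev := (eval R q p c).

Lemma sqrt_q_neq0 : p != 0.
Proof. by rewrite fmorph_eq0 gt_eqF ?powR_gt0. Qed.

Lemma sqrt_qK : p ^+ 2 = q%:C.
Proof.
rewrite -rmorphXn /= -powR_mulrn ?powR_ge0 // -powRrM mulVf ?pnatr_eq0 //.
by rewrite powRr1 // ltW.
Qed.

(** Since q < 1 < q^-1; this allows the division by s. *)
Lemma q_sub_inv_neq0 : q - q^-1 != 0.
Proof. by rewrite subr_eq0 lt_eqF // (lt_trans q_lt1) // invf_gt1. Qed.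

Lemma sinhq1E : s = p ^+ 2 - p ^- 2.
Proof.
by rewrite /s /sinhq powRr1 ?ltW // powR_inv1 ?ltW // rmorphB /= fmorphV sqrt_qK.
Qed.

Lemma coshq1E : coshq q 1 = p ^+ 2 + p ^- 2.
Proof.
by rewrite /coshq powRr1 ?ltW // powR_inv1 ?ltW // rmorphD /= fmorphV sqrt_qK.
Qed.

Lemma coshq2E : coshq q 2 = p ^+ 4 + p ^- 4.
Proof.
rewrite /coshq powRN powR_mulrn ?ltW // rmorphD /= fmorphV !rmorphXn /= -sqrt_qK.
by rewrite -!exprM.
Qed.

Lemma sinhq1_neq0 : s != 0.
Proof. by rewrite sinhq1E sqrt_qK -fmorphV -rmorphB fmorph_eq0 q_sub_inv_neq0. Qed.

Lemma evalD x y : ev (x + y)%X = ev x + ev y. Proof. by []. Qed.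

Lemma evalM x y : ev (x * y)%X = ev x * ev y. Proof. by []. Qed.

Lemma evalN x : ev (- x)%X = - ev x.
Proof. by rewrite /= /coef_eval expr0z big_nil !mulr1 mulr_algl scaleN1r. Qed.

Lemma evalB x y : ev (x - y)%X = ev x - ev y.
Proof. by rewrite evalD evalN. Qed.

Lemma eval_xvar i : ev (xvar i) = (c i)%:A.
Proof. by rewrite /= /coef_eval expr0z big_seq1 !mul1r. Qed.

Lemma eval_xpow n : ev (xpow n) = (p ^ n)%:A.
Proof. by rewrite /= /coef_eval big_nil mul1r mulr1. Qed.

Lemma eval_xsinh1sq : ev xsinh1sq = (s ^+ 2)%:A.
Proof.
by rewrite evalM evalB !eval_xpow -scalerBl mulr_algl scalerA sinhq1E.
Qed.

Lemma eval_xcosh1 : ev xcosh1 = (coshq q 1)%:A.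
Proof. by rewrite evalD !eval_xpow -scalerDl coshq1E. Qed.

Lemma eval_xcosh2 : ev xcosh2 = (coshq q 2)%:A.
Proof. by rewrite evalD !eval_xpow -scalerDl coshq2E. Qed.

Lemma vanishes_sub x y : vanishes (x - y) -> ev x = ev y.
Proof.
move/(vanishesP _ _ _ c sqrt_q_neq0 sqrt_qK q_sub_inv_neq0)/eqP.
by rewrite evalB subr_eq0 => /eqP.
Qed.

Lemma xrelP K L S M C W : vanishes (xrel K L S M C W) ->
  coshq q 2 *: (ev K * ev L * ev K) - ev K ^+ 2 * ev L - ev L * ev K ^+ 2
  = s ^+ 2 *: (ev S * ev K) - coshq q 1 ^+ 2 *: (ev M * ev L)
    + coshq q 1 *: (ev C + s ^+ 2 *: ev W).
Proof.
move/vanishes_sub.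
rewrite !(eval_xsinh1sq, eval_xcosh1, eval_xcosh2, evalB, evalD, evalM).
by rewrite !mulr_algl scalerA mulr_algl -!expr2.
Qed.

Lemma xAWP K L A0 A1 A2 A3 A4 A5 : xAW K L A0 A1 A2 A3 A4 A5 ->
  AW q (ev K) (ev L) (ev A0) (ev A1) (ev A2) (ev A3) (ev A4) (ev A5).
Proof.
by case/andP=> /xrelP r1 /xrelP r2; split; rewrite ?r1 ?r2 !evalB !evalM.
Qed.

Lemma xcommP x y : xcomm x y -> GRing.comm (ev x) (ev y).
Proof. by move/vanishes_sub; rewrite !evalM. Qed.

(** Quantifying over the morphism lets one verification per element cover both embeddings and
    [Delta]. The images of E and F carry the factor s because [gen_eval] interprets these generators
    as E' and F'. *)
Definition represents (X : expr -> expr -> expr -> expr -> expr) (Y : Uq q) : Prop :=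
  forall (phi : {lrmorphism Uq q -> Uq2 q}) (k ki e f : expr),
    ev k = phi Khat -> ev ki = phi Khat_inv ->
    ev e = s *: phi Ehat -> ev f = s *: phi Fhat -> ev (X k ki e f) = phi Y.

Lemma xYK_represents : represents xYK (Y_K q aE aF a_s).
Proof.
move=> phi k ki e f kE _ eE fE.
rewrite !(evalD, evalM) kE eE fE eval_xvar !rmorphD /= !linearZ /= !rmorphM /=.
rewrite /coef_eval !big_seq1 !mulr_algl -!scalerAl !scalerA !mul1r.
(* The s of E' and F' cancels the s^-1 in the parameters, and q^(-1/2) becomes p^-1. *)
by rewrite powRN fmorphV /c /= -!mulrA mulVf ?sinhq1_neq0 // !mulr1.
Qed.

Lemma xYL_represents : represents xYL (Y_L q bE bF b_t).
Proof.
move=> phi k ki e f _ kiE eE fE.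
rewrite !(evalD, evalM) kiE eE fE eval_xvar !rmorphD /= !linearZ /= !rmorphM /=.
rewrite /coef_eval !big_seq1 !mulr_algl -!scalerAl !scalerA !mul1r.
by rewrite powRN fmorphV /c /= -!mulrA mulVf ?sinhq1_neq0 // !mulr1.
Qed.

Lemma xOmega_represents : represents xOmega (Omega q).
Proof.
move=> phi k ki e f kE kiE eE fE.
rewrite !(evalD, evalM) kE kiE eE fE !eval_xpow !rmorphD /= !linearZ /=.
rewrite !rmorphM /= !mulr_algl -!scalerAl -!scalerAr !scalerA -expr2.
by rewrite fmorphV /= -sqrt_qK.
Qed.

Lemma eval_xtheta : ev xtheta = (theta q aE aF bE bF)%:A.
Proof.
rewrite evalN /= /coef_eval !big_cons big_nil -scalerDl -scaleNr /theta.
rewrite -/s expr0z !mul1r !mulr1 /c /=; congr (_ *: _).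
(* Generalizing [s] makes it an atom for [field], known only to be nonzero. *)
move: (s) sinhq1_neq0 => d d0; field; exact: d0.
Qed.

Lemma eval_xaEaF : ev xaEaF = (aE * aF)%:A.
Proof.
rewrite evalM eval_xsinh1sq /= /coef_eval !big_cons big_nil mulr_algl scalerA.
rewrite -/s expr0z !mul1r !mulr1 /c /=; congr (_ *: _).
move: (s) sinhq1_neq0 => d d0; field; exact: d0.
Qed.

Lemma eval_xbEbF : ev xbEbF = (bE * bF)%:A.
Proof.
rewrite evalM eval_xsinh1sq /= /coef_eval !big_cons big_nil mulr_algl scalerA.
rewrite -/s expr0z !mul1r !mulr1 /c /=; congr (_ *: _).
move: (s) sinhq1_neq0 => d d0; field; exact: d0.
Qed.

Lemma eval_Nxsinh1sq : ev (- xsinh1sq)%X = (- s ^+ 2)%:A.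
Proof. by rewrite evalN eval_xsinh1sq scaleNr. Qed.

(** By linearity E' and F' have the same coproduct formulas as E and F. *)
Lemma eval_Delta_gens :
  [/\ ev (XGen false GK * XGen true GK)%X = Delta Khat,
      ev (XGen false GKinv * XGen true GKinv)%X = Delta Khat_inv,
      ev (XGen false GK * XGen true GE + XGen false GE * XGen true GKinv)%X
        = s *: Delta Ehat &
      ev (XGen false GK * XGen true GF + XGen false GF * XGen true GKinv)%X
        = s *: Delta Fhat].
Proof.
have [-> -> -> ->] := Delta_generators q.
rewrite /= !scalerDr -!sinhq1E; split; rewrite ?[LHS]tpureM ?mulr1 ?mul1r //.
- rewrite [X in X + _]tpureM [X in _ + X]tpureM !mulr1 !mul1r.
  by rewrite [X in X + _]tpureZr [X in _ + X]tpureZl.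
- rewrite [X in X + _]tpureM [X in _ + X]tpureM !mulr1 !mul1r.
  by rewrite [X in X + _]tpureZr [X in _ + X]tpureZl.
Qed.

Lemma eval_represents X Y : represents X Y ->
  [/\ ev (xleft X) = Y \ox 1, ev (xright X) = 1 \ox Y & ev (xDelta X) = Delta Y].
Proof.
have [kE kiE eE fE] := eval_Delta_gens.
move=> XY; split; last exact: (XY (@Delta R q)).
- apply: (XY (left_tensor R q)) => //; rewrite /= -sinhq1E.
    exact: tpureZl.
  exact: tpureZl.
- apply: (XY (right_tensor R q)) => //; rewrite /= -sinhq1E.
    exact: tpureZr.
  exact: tpureZr.
Qed.

End Interpretation.

Theorem theorem3p1 (R : realType) (q : R) (q_gt0 : 0 < q) (q_lt1 : q < 1)
    (aE aF a_s bE bF b_t : R[i]) :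
  let YK : Uq q := Y_K q aE aF a_s in
  let YL : Uq q := Y_L q bE bF b_t in
  let th : R[i] := theta q aE aF bE bF in
  let one_YK : Uq2 q := 1 \ox YK in
  let YL_one : Uq2 q := YL \ox 1 in
  let one_Omega : Uq2 q := 1 \ox Omega q in
  let Omega_one : Uq2 q := Omega q \ox 1 in
  (AW q (Delta YK) (Delta YL)
        a_s%:A b_t%:A th%:A (Delta (Omega q)) (bE * bF)%:A (aE * aF)%:A
   /\ AW q one_YK (Delta YL)
        a_s%:A YL_one th%:A one_Omega (bE * bF)%:A (aE * aF)%:A
   /\ AW q (Delta YK) YL_one
        one_YK b_t%:A th%:A Omega_one (bE * bF)%:A (aE * aF)%:A
   /\ AW q one_YK (Delta (Omega q))
        a_s%:A Omega_one (- Delta YK) one_Omega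
        (- sinhq q 1 ^+ 2)%:A (aE * aF)%:A
   /\ AW q (Delta (Omega q)) YL_one
        one_Omega b_t%:A (- Delta YL) Omega_one
        (bE * bF)%:A (- sinhq q 1 ^+ 2)%:A)
  /\
  (GRing.comm one_YK (Delta YK)
   /\ GRing.comm one_YK YL_one
   /\ GRing.comm YL_one (Delta YL)
   /\ GRing.comm (Delta YK) (Delta (Omega q))
   /\ GRing.comm (Delta YL) (Delta (Omega q))).
Proof.
move=> YK YL th one_YK YL_one one_Omega Omega_one.
(* Each element in the statement is the value of an expression, so the computed identities transfer
   to it by rewriting. *)
have [_ YKr YKD] := eval_represents _ _ q_gt0 aE aF a_s bE bF b_t _ _
  (xYK_represents _ _ q_gt0 q_lt1 aE aF a_s bE bF b_t).
have [YLl _ YLD] := eval_represents _ _ q_gt0 aE aF a_s bE bF b_t _ _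
  (xYL_represents _ _ q_gt0 q_lt1 aE aF a_s bE bF b_t).
have [Oml Omr OmD] := eval_represents _ _ q_gt0 aE aF a_s bE bF b_t _ _
  (xOmega_represents _ _ q_gt0 aE aF a_s bE bF b_t).
have asE := eval_xvar _ q aE aF a_s bE bF b_t 2.
have btE := eval_xvar _ q aE aF a_s bE bF b_t 5.
have thE := eval_xtheta _ _ q_gt0 q_lt1 aE aF a_s bE bF b_t.
have aaE := eval_xaEaF _ _ q_gt0 q_lt1 aE aF a_s bE bF b_t.
have bbE := eval_xbEbF _ _ q_gt0 q_lt1 aE aF a_s bE bF b_t.
have s2E := eval_Nxsinh1sq _ _ q_gt0 aE aF a_s bE bF b_t.
have NE := evalN _ q aE aF a_s bE bF b_t.
have AWx := xAWP _ _ q_gt0 q_lt1 aE aF a_s bE bF b_t.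
have commx := xcommP _ _ q_gt0 q_lt1 aE aF a_s bE bF b_t.
split; [split; [|split; [|split; [|split]]] | split; [|split; [|split; [|split]]]].
- by move/AWx: xAW_Delta_Delta; rewrite YKD YLD OmD asE btE thE bbE aaE.
- by move/AWx: xAW_right_Delta; rewrite YKr YLD asE YLl thE Omr bbE aaE.
- by move/AWx: xAW_Delta_left; rewrite YKD YLl YKr btE thE Oml bbE aaE.
- by move/AWx: xAW_right_Omega; rewrite s2E NE YKr OmD asE Oml YKD Omr aaE.
- by move/AWx: xAW_Omega_left; rewrite s2E NE OmD YLl Omr btE YLD Oml bbE.
(* For the remaining pairs the commutator itself has empty normal form. *)
- by rewrite /one_YK -YKr -YKD; apply: commx; vm_compute.
- by rewrite /one_YK /YL_one -YKr -YLl; apply: commx; vm_compute.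
- by rewrite /YL_one -YLl -YLD; apply: commx; vm_compute.
- by rewrite -YKD -OmD; apply: commx; vm_compute.
- by rewrite -YLD -OmD; apply: commx; vm_compute.
Qed.
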